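(* Let $f(x)=\sin^2 x+\frac{1}{x}$ and let $T\subset\mathbb{R}^2$ be the union of the graph $\{(x,f(x)) : x\in[\pi,\infty)\}$, the ray $\{(x,0) : x\in[\pi,\infty)\}$, and the vertical segment $\{\pi\}\times[0,1/\pi]$. Equip $T$ with the uniform structure induced by the usual Euclidean metric on the plane. Then $T$ is path connected, and as a uniform space $T$ is uniformly joinable but not locally uniformly joinable.
   Context: Entourages: throughout, entourages of a uniform space are taken to be symmetric (the symmetric entourages form a base of the uniform structure); every entourage contains the diagonal. For a metric space $(X,d)$, the induced uniform structure has as a base the sets $E_\epsilon=\{(x,y)\in X\times X : d(x,y)\le\epsilon\}$, $\epsilon>0$. Chains: given an entourage $E$ of a uniform space $X$, an $E$-chain is a finite sequence $x_1,\dots,x_n$ of points of $X$ with $(x_i,x_{i+1})\in E$ for each $i<n$; it joins $x_1$ to $x_n$. Homotopy of chains: a subset $A\subset X$ is $E$-bounded if $A\times A\subset E$. The Rips complex $R(X,E)$ is the simplicial complex with vertex set $X$ whose simplices are the finite $E$-bounded subsets of $X$. An $E$-chain determines an edge path in $R(X,E)$ by joining successive terms by edges. Two $E$-chains with the same initial point and the same final point are $E$-homotopic if the corresponding paths in $R(X,E)$ are homotopic relative to endpoints; equivalently, one can be transformed into the other by finitely many moves, each adding or deleting a single point and yielding an $E$-chain, with endpoints kept fixed. The $E$-homotopy class of an $E$-chain $c$ is denoted $[c]_E$. Generalized paths: a generalized path from $x$ to $y$ in $X$ is a family $\alpha=\{[c_E]_E\}_E$, indexed by all entourages $E$ of $X$,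 where each $c_E$ is an $E$-chain from $x$ to $y$ and, whenever $F\subset E$ are entourages, $c_F$ is $E$-homotopic to $c_E$. Write $\alpha_E=[c_E]_E$. A generalized path $\alpha$ from $x$ to $y$ is $E$-short if $(x,y)\in E$ and $\alpha_E=[x,y]_E$, the class of the two-term $E$-chain $x,y$. A uniform space $X$ is uniformly joinable if every pair of points of $X$ can be joined by a generalized path. It is locally uniformly joinable if for each entourage $E$ of $X$ there is an entourage $F$ of $X$ such that whenever $(x,y)\in F$, the points $x$ and $y$ can be joined by an $E$-short generalized path. *)

(* Defs.v *)
From HB Require Import structures.
From mathcomp Require Import all_boot all_order all_algebra.
From mathcomp Require Import ring.
From mathcomp Require Import all_classical all_reals all_analysis.
From Stdlib Require Import Relation_Operators.

Set Implicit Arguments.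
Unset Strict Implicit.
Unset Printing Implicit Defensive.

Import Order.TTheory GRing.Theory Num.Theory.
Import numFieldNormedType.Exports.

Local Open Scope classical_set_scope.
Local Open Scope ring_scope.

Definition symmetric_entourage (X : uniformType) (E : set (X * X)) : Prop :=
  entourage E /\ (E^-1)%relation = E.

Definition sentourage (X : uniformType) : Type :=
  {E : set (X * X) | symmetric_entourage E}.

Section Chains.
Context {X : Type}.
Implicit Types (E : set (X * X)) (x y : X) (c d : seq X).

Definition chain E x y c : Prop :=
  if c is z :: s then
    [/\ z = x, path (fun a b => `[< E (a, b) >]) z s & last z s = y]
  else False.

Definition add_point c d : Prop :=
  exists s z t, c = s ++ t /\ d = s ++ z :: t.

Definition chain_move E x y c d : Prop :=
  [/\ chain E x y c, chain E x y d & add_point c d \/ add_point d c].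

(* Homotopy rel endpoints in the Rips complex R(X, E), by elementary moves: for
   symmetric E containing the diagonal, inserting or deleting a point exchanges
   one edge and the other two edges of a (possibly degenerate) triangle of
   R(X, E). *)
Definition homotopic E x y c d : Prop :=
  [/\ chain E x y c, chain E x y d
    & clos_refl_trans (seq X) (chain_move E x y) c d].

Definition homotopy_class E x y c : set (seq X) :=
  [set d | homotopic E x y c d].

End Chains.

Record generalized_path (X : uniformType) (x y : X) := GeneralizedPath {
  path_class :> sentourage X -> set (seq X);
  path_classP : exists c : sentourage X -> seq X,
    [/\ forall E, chain (sval E) x y (c E),
        forall E, path_class E = homotopy_class (sval E) x y (c E)
      & forall E F : sentourage X, sval F `<=` sval E ->
          homotopic (sval E) x y (c F) (c E)]
}.

Definition short (X : uniformType) (E : sentourage X) (x y : X)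
    (alpha : generalized_path x y) : Prop :=
  sval E (x, y) /\ alpha E = homotopy_class (sval E) x y [:: x; y].

Definition uniformly_joinable (X : uniformType) : Prop :=
  forall x y : X, inhabited (generalized_path x y).

Definition locally_uniformly_joinable (X : uniformType) : Prop :=
  forall E : sentourage X, exists F : sentourage X, forall x y : X,
    sval F (x, y) -> exists alpha : generalized_path x y, short E alpha.

Definition path_connected (R : realType) (X : topologicalType) : Prop :=
  forall x y : X, exists g : R -> X,
    [/\ {within `[0, 1], continuous g}, g 0 = x & g 1 = y].

(* R * R itself carries the max metric; this alias carries the Euclidean one. *)
Definition plane (R : realType) : Type := (R * R)%type.

Section EuclideanPlane.
Variable R : realType.
Implicit Types p q r : plane R.

Definition euclidean_dist p q : R :=
  Num.sqrt ((p.1 - q.1) ^+ 2 + (p.2 - q.2) ^+ 2).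

Let distxx p : euclidean_dist p p = 0.
Proof. by rewrite /euclidean_dist !subrr expr0n addr0 sqrtr0. Qed.

Let dist_positivity p q : euclidean_dist p q = 0 -> p = q.
Proof.
case: p q => [a b] [c d] /eqP; rewrite /euclidean_dist /= sqrtr_eq0.
move=> le0; have : (a - c) ^+ 2 + (b - d) ^+ 2 == 0.
  by rewrite eq_le le0 addr_ge0 ?sqr_ge0.
rewrite paddr_eq0 ?sqr_ge0// !sqrf_eq0 !subr_eq0.
by move=> /andP[/eqP-> /eqP->].
Qed.

Let dist_sym p q : euclidean_dist p q = euclidean_dist q p.
Proof. by rewrite /euclidean_dist -sqrrN opprB -[(p.2 - _) ^+ 2]sqrrN opprB. Qed.

Let minkowski (a b c d : R) : Num.sqrt ((a + c) ^+ 2 + (b + d) ^+ 2) <=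
  Num.sqrt (a ^+ 2 + b ^+ 2) + Num.sqrt (c ^+ 2 + d ^+ 2).
Proof.
have ge0 (u v : R) : 0 <= u ^+ 2 + v ^+ 2 by rewrite addr_ge0 ?sqr_ge0.
set A := a ^+ 2 + b ^+ 2; set C := c ^+ 2 + d ^+ 2.
have A0 : 0 <= A by exact: ge0.
have C0 : 0 <= C by exact: ge0.
have cauchy : a * c + b * d <= Num.sqrt A * Num.sqrt C.
  rewrite (le_trans (ler_norm _))// -sqrtrM// -sqrtr_sqr ler_wsqrtr//.
  have -> : A * C = (a * c + b * d) ^+ 2 + (a * d - b * c) ^+ 2.
    by rewrite /A /C; ring.
  by rewrite lerDl sqr_ge0.
rewrite -ler_sqr ?nnegrE ?addr_ge0 ?sqrtr_ge0//.
rewrite sqr_sqrtr// [leRHS]sqrrD !sqr_sqrtr//.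
have -> : (a + c) ^+ 2 + (b + d) ^+ 2 = A + (a * c + b * d) *+ 2 + C.
  by rewrite /A /C; ring.
by rewrite lerD2r lerD2l lerMn2r cauchy orbT.
Qed.

Let dist_triangle q p r :
  euclidean_dist p r <= euclidean_dist p q + euclidean_dist q r.
Proof.
rewrite /euclidean_dist -(subrKA q.1 p.1 (- r.1)) -(subrKA q.2 p.2 (- r.2)).
exact: minkowski.
Qed.

HB.instance Definition _ := Choice.on (plane R).
HB.instance Definition _ := @isMetric.Build R (plane R)
  euclidean_dist distxx dist_positivity dist_sym dist_triangle.

Definition T_fun (x : R) : R := sin x ^+ 2 + x^-1.

(* Used as a type, this set carries the subspace uniformity of [plane R];
   [entourage_T_spaceP] spells it out. *)
Definition T_space : set (plane R) :=
  [set (x, T_fun x) | x in `[pi, +oo[] `|` [set (x, 0) | x in `[pi, +oo[]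
  `|` [set (pi, y) | y in `[0, pi^-1]].

Lemma entourage_T_spaceP (A : set (T_space * T_space)) :
  entourage A <-> exists2 e : R, 0 < e &
    [set uv : T_space * T_space | euclidean_dist (\val uv.1) (\val uv.2) <= e]
      `<=` A.
Proof.
split.
  case=> B; rewrite -entourage_ballE => -[e /= e0 eB] BA.
  exists (e / 2); first by rewrite divr_gt0.
  move=> -[u v] /= uve; apply: BA; apply: eB => /=; rewrite ballEmdist /=.
  by rewrite (le_lt_trans uve)// ltr_pdivrMr// ltr_pMr// ltr1n.
case=> e e0 eA; exists [set pq | ball pq.1 e pq.2].
  by rewrite -entourage_ballE; exists e.
by move=> -[u v] /=; rewrite ballEmdist /= => uve; apply: eA; exact: ltW.
Qed.

End EuclideanPlane.

Arguments T_space R : clear implicits.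

(* Main.v *)
Require Import Defs.
From mathcomp Require Import all_boot all_order all_algebra.
From mathcomp Require Import all_classical all_reals all_analysis.
From mathcomp Require Import ring lra.
From Stdlib Require Import Relation_Operators.

(**
The space T is a line folded in the plane: it comes in along the ray, climbs
the vertical segment and leaves along the graph, so it is the image of R under
one continuous map ([line_to_T]). This gives path connectedness.

In every uniform space a path g on [0, 1] yields a generalized path
([path_generalized_path]). For an entourage E, cut [0, 1] into intervals whose
images are E-small; the images of the cut points form an E-chain. Any two such
subdivisions give E-homotopic chains, because points of one can be inserted in
the other one at a time ([subdivision_homotopic]), and a subdivision that is
fine enough for F is fine enough for every E containing F. Hence T is uniformly
joinable.

Local uniform joinability fails because of the points where the sine vanishes.
At x = n pi the graph and the ray are at distance 1 / (n pi), so for every F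
some such pair p = (x, f x), q = (x, 0) is in F. Between two consecutive points
of this kind the graph rises to height above 1, so at a fixed small scale e the
graph and the ray can only be linked through these narrow places, as in a
ladder whose rungs are separated by holes. Counting with sign how often a chain
uses the rung at x = n pi, that is jumps from graph to ray for a first
coordinate within pi / 2 of n pi, gives a 1-cocycle of the Rips complex at
scale e ([crossing_cocycle]), so the count only depends on the homotopy class
([cochain_sum_homotopic]). For an e-short generalized path from p to q the count
is that of the chain p, q, namely 1. But the same class contains chains of
arbitrarily fine scale, and a chain finer than the gap between graph and ray
over this bounded window never jumps there ([crossing_fine]), so its count
is 0.
*)

Set Implicit Arguments.
Unset Strict Implicit.
Unset Printing Implicit Defensive.

Import Order.TTheory GRing.Theory Num.Theory.
Import numFieldNormedType.Exports.

Local Open Scope classical_set_scope.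
Local Open Scope ring_scope.

(** * Homotopy of chains *)

Lemma homotopic_refl (X : Type) (E : set (X * X)) x y c :
  chain E x y c -> homotopic E x y c c.
Proof. by move=> cc; split=> //; exact: rt_refl. Qed.

Lemma homotopic_sym (X : Type) (E : set (X * X)) x y c d :
  homotopic E x y c d -> homotopic E x y d c.
Proof.
case=> Ec Ed cd; split=> //; elim: cd => [a b [Ea Eb ab]|a|a b e _ ba _ eb].
- by apply: rt_step; split=> //; case: ab; [right|left].
- exact: rt_refl.
- exact: rt_trans eb ba.
Qed.

Lemma homotopic_trans (X : Type) (E : set (X * X)) x y d c e :
  homotopic E x y c d -> homotopic E x y d e -> homotopic E x y c e.
Proof. by move=> [Ec _ cd] [_ Ee de]; split=> //; exact: rt_trans cd de. Qed.

Lemma homotopic_add_point (X : Type) (E : set (X * X)) x y c d :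
  chain E x y c -> chain E x y d -> add_point c d -> homotopic E x y c d.
Proof. by move=> Ec Ed cd; split=> //; apply: rt_step; split=> //; left. Qed.

Lemma chain_cons (X : Type) (E : set (X * X)) z x y c :
  E (z, x) -> chain E x y c -> chain E z y (z :: c).
Proof.
case: c => // a s Ezx [-> ps ls]; split=> //=.
by rewrite ps andbT; apply/asboolP.
Qed.

Lemma homotopic_cons (X : Type) (E : set (X * X)) z x y c d :
  E (z, x) -> homotopic E x y c d -> homotopic E z y (z :: c) (z :: d).
Proof.
move=> Ezx [Ec Ed cd]; split; [exact: chain_cons Ec|exact: chain_cons Ed|].
have addc a b : add_point a b -> add_point (z :: a) (z :: b).
  by case=> s [w [t [-> ->]]]; exists (z :: s), w, t.
elim: cd => [a b [Ea Eb ab]|a|a b e _ ab _ be].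
- apply: rt_step; split; [exact: chain_cons Ea|exact: chain_cons Eb|].
  by case: ab => /addc; [left|right].
- exact: rt_refl.
- exact: rt_trans ab be.
Qed.

(** * Generalized paths from paths *)

(** Fineness is a condition on the image of the interval rather than a bound on
    its length: it passes to subintervals, and from an entourage to any larger
    one, whatever the modulus of continuity of g. *)
Definition small_on (R : realType) (X : Type) (E : set (X * X)) (g : R -> X)
    (s t : R) : bool :=
  (s <= t) &&
  `[< forall u v, s <= u <= t -> s <= v <= t -> E (g u, g v) >].

Lemma small_onP (R : realType) (X : Type) (E : set (X * X)) (g : R -> X) s t :
  small_on E g s t -> s <= t /\
  forall u v, s <= u <= t -> s <= v <= t -> E (g u, g v).
Proof. by move=> /andP[? /asboolP]. Qed.

Lemma small_onW (R : realType) (X : Type) (E : set (X * X)) (g : R -> X)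
    s t s' t' : small_on E g s t -> s <= s' -> s' <= t' -> t' <= t ->
  small_on E g s' t'.
Proof.
move=> /small_onP[st sm] ss' st' tt'; rewrite /small_on st'; apply/asboolP.
by move=> u v /andP[s'u ut'] /andP[s'v vt']; apply: sm; lra.
Qed.

Lemma small_on_ends (R : realType) (X : Type) (E : set (X * X)) (g : R -> X)
    s t : small_on E g s t -> E (g s, g t).
Proof. by move=> /small_onP[st]; apply; rewrite ?lexx ?st. Qed.

Lemma subdivision_le_last (R : realType) (X : Type) (E : set (X * X))
    (g : R -> X) x s :
  path (small_on E g) x s -> x <= last x s.
Proof.
elim: s x => //= a s IH x /andP[/small_onP[xa _] /IH]; exact: le_trans.
Qed.

Lemma subdivision_chain (R : realType) (X : Type) (E : set (X * X))
    (g : R -> X) x s :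
  path (small_on E g) x s ->
  chain E (g x) (g (last x s)) (map g (x :: s)).
Proof.
elim: s x => [|a s IH] x //= /andP[xa /IH].
exact: chain_cons (small_on_ends xa).
Qed.

(** By induction on the total length: of the two first cut points after x, the
    smaller one can be inserted in the other subdivision, after which both chains
    begin with the same edge and their tails are compared. *)
Lemma subdivision_homotopic (R : realType) (X : Type) (E : set (X * X))
    (g : R -> X) x s t :
  path (small_on E g) x s -> path (small_on E g) x t ->
  last x s = last x t ->
  homotopic E (g x) (g (last x t)) (map g (x :: s)) (map g (x :: t)).
Proof.
have [n] := ubnP (size s + size t).
elim: n x s t => // n IH x s t.
(* A single point comes first, then the subdivision with the smaller second
   point: this is where the symmetry of the claim is used. *)
pose lexhead (s t : seq R) :=
  if s is a :: _ then if t is b :: _ then a <= b else false else true.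
wlog st : s t / lexhead s t.
  move=> W; have [|ts] := boolP (lexhead s t); first exact: W.
  rewrite addnC => szts ps pt e; rewrite -e; apply/homotopic_sym/W => //.
  move: ts; rewrite /lexhead; case: (s) (t) => [|a s'] [|b t'] //.
  by rewrite -ltNge => /ltW.
case: s t st => [|a s] [|b t] st szst ps pt.
- by move=> _; exact: homotopic_refl.
(* The first chain is a single point, so the second one stays at x: repeat x. *)
- move=> /= xe; move: pt => /= /andP[xb pt].
  have bx : b = x.
    apply/eqP; rewrite eq_le; case/small_onP: (xb) => -> _; rewrite andbT xe.
    exact: subdivision_le_last pt.
  subst b; rewrite -xe; have Exx := small_on_ends xb.
  have mv : homotopic E (g x) (g x) [:: g x] [:: g x; g x].
    apply: homotopic_add_point => //; first exact: chain_cons Exx _.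
    by exists [::], (g x), [:: g x].
  apply: homotopic_trans mv _; apply: (homotopic_cons Exx).
  by rewrite {2}xe; apply: (IH x [::] t).
- by [].
move: (ps) (pt) => /= /andP[xa pa] /andP[xb pb] e.
have [[xa' _] [xb' _]] := (small_onP xa, small_onP xb).
have ab : small_on E g a b by exact: small_onW xb xa' st _.
have mv : homotopic E (g x) (g (last b t)) (map g [:: x, a, b & t])
                    (map g [:: x, b & t]).
  apply/homotopic_sym/homotopic_add_point.
  - exact: (subdivision_chain (s := b :: t)).
  - by apply: (subdivision_chain (s := [:: a, b & t])); rewrite /= xa ab.
  - by exists [:: g x], (g a), (map g (b :: t)).
apply: homotopic_trans mv; apply: (homotopic_cons (small_on_ends xa)).
apply: (IH a s (b :: t)) => //=; last by rewrite ab.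
Qed.

Lemma path_locally_small (R : realType) (X : uniformType) (E : set (X * X))
    (g : R -> X) (c : R) :
  entourage E -> {within `[0, 1], continuous g} -> 0 <= c <= 1 ->
  exists2 e : R, 0 < e & forall u v, 0 <= u <= 1 -> 0 <= v <= 1 ->
    `|u - c| < e -> `|v - c| < e -> E (g u, g v).
Proof.
move=> entE cg c01.
have cI : `[0, 1]%classic c by rewrite /= in_itv.
have sE := entourage_split_ent entE.
have sE' : entourage (split_ent E `&` (split_ent E)^-1%relation).
  by apply: filterI => //; exact: entourage_inv.
have /cvg_app_entourageP /(_ _ sE') := cg c.
rewrite /nbhs /= -nbhs_subspace_in//.
move=> /nbhs_ballP[e /= e0 ce]; exists e => // u v u01 v01 uc vc.
have [] := ce u; first by rewrite -ball_normE /= distrC.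
  by rewrite in_itv.
have [] := ce v; first by rewrite -ball_normE /= distrC.
  by rewrite in_itv.
by move=> cv _ _ uc'; exact: entourage_split uc' cv.
Qed.

(** Compactness of the unit interval by a supremum argument: the set A of
    endpoints of fine subdivisions starting at 0 has a supremum c; since g is
    E-small near c, a subdivision ending just before c extends beyond c, unless
    c = 1. *)
Lemma path_subdivision (R : realType) (X : uniformType) (E : set (X * X))
    (g : R -> X) : entourage E -> {within `[0, 1], continuous g} ->
  exists2 s, path (small_on E g) 0 s & last 0 s = 1.
Proof.
move=> entE cg.
pose A := [set t : R | 0 <= t <= 1 /\
                       exists2 s, path (small_on E g) 0 s & last 0 s = t].
have A0 : A 0 by split; [rewrite lexx ler01|exists [::]].
have ubA : ubound A 1 by move=> t [/andP[]].
have supA : has_sup A by split; [exists 0|exists 1].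
have hubA : has_ubound A by exists 1.
have c01 : 0 <= sup A <= 1.
  by rewrite ub_le_sup//= ge_sup//; exists 0.
have [e e0 smallE] := path_locally_small entE cg c01.
have [a Aa ca] := sup_adherent e0 supA.
have ac : a <= sup A by exact: ub_le_sup.
have [/andP[a0 a1] [s ps ls]] := Aa.
pose b := Num.min 1 (sup A + e / 2).
have ab : a <= b by rewrite /b le_min; apply/andP; split=> //; lra.
have b1 : b <= 1 by rewrite /b ge_min lexx.
have bc : b <= sup A + e / 2 by rewrite /b ge_min lexx orbT.
have Ab : A b.
  split; first by rewrite b1 andbT (le_trans a0).
  exists (rcons s b); last by rewrite last_rcons.
  rewrite rcons_path ps ls /small_on ab /=; apply/asboolP => u v /andP[au ub].
  by move=> /andP[av vb]; apply: smallE; rewrite ?ltr_norml; lra.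
have bs : b <= sup A by exact: ub_le_sup.
have {}b1 : b = 1.
  by move: bs; rewrite /b /Num.min; case: ifP => // _; lra.
by case: Ab => _; rewrite b1.
Qed.

Lemma path_generalized_path (R : realType) (X : uniformType) (g : R -> X) :
  {within `[0, 1], continuous g} -> inhabited (generalized_path (g 0) (g 1)).
Proof.
move=> cg.
have ex (E : sentourage X) : exists s : seq R,
    path (small_on (sval E) g) 0 s /\ last 0 s = 1.
  by have [s ps ls] := path_subdivision (svalP E).1 cg; exists s.
have [sub subP] := choice ex.
pose c E := map g (0 :: sub E).
constructor; exists (fun E => homotopy_class (sval E) (g 0) (g 1) (c E)).
exists c; split=> // [E|E F FE].
  by have [ps <-] := subP E; exact: subdivision_chain.
have [[pE lE] [pF lF]] := (subP E, subP F).
rewrite -lE; apply: subdivision_homotopic; rewrite ?lE ?lF//.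
apply: sub_path pF => s t /small_onP[st sm]; rewrite /small_on st.
by apply/asboolP => u v su sv; apply/FE/sm.
Qed.

Lemma path_connected_uniformly_joinable (R : realType) (X : uniformType) :
  path_connected R X -> uniformly_joinable X.
Proof.
by move=> pc x y; have [g [cg <- <-]] := pc x y; exact: path_generalized_path.
Qed.

(** * The space T as a folded line *)

Lemma coord_le_euclidean_dist (R : realType) (p q : plane R) :
  `|p.1 - q.1| <= euclidean_dist p q /\ `|p.2 - q.2| <= euclidean_dist p q.
Proof.
rewrite /euclidean_dist -!sqrtr_sqr.
by split; rewrite ler_wsqrtr// ?lerDl ?lerDr sqr_ge0.
Qed.

Lemma euclidean_dist_le_coord (R : realType) (p q : plane R) :
  euclidean_dist p q <= `|p.1 - q.1| + `|p.2 - q.2|.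
Proof.
rewrite /euclidean_dist -[leRHS]ger0_norm ?addr_ge0//.
rewrite -[leRHS]sqrtr_sqr ler_wsqrtr//.
rewrite [leRHS]sqrrD !real_normK ?num_real// addrAC lerDl.
by rewrite mulrn_wge0// mulr_ge0.
Qed.

Definition pos_part (R : realType) (z : R) : R := Num.max z 0.

Lemma pos_partE (R : realType) (z : R) : pos_part z = (z + `|z|) / 2.
Proof.
rewrite /pos_part; have [z0|z0] := leP z 0.
  by rewrite ler0_norm// subrr mul0r.
by rewrite gtr0_norm//; lra.
Qed.

Lemma pos_part_ge0 (R : realType) (z : R) : 0 <= pos_part z.
Proof. by rewrite /pos_part le_max lexx orbT. Qed.

Lemma pos_part_id (R : realType) (z : R) : 0 <= z -> pos_part z = z.
Proof. by move=> z0; rewrite /pos_part max_l. Qed.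

Lemma pos_part_eq0 (R : realType) (z : R) : z <= 0 -> pos_part z = 0.
Proof. by move=> z0; rewrite /pos_part max_r. Qed.

Lemma continuous_pos_part (R : realType) : continuous (@pos_part R).
Proof.
move=> z; rewrite (_ : @pos_part R = fun z => (z + `|z|) / 2); last first.
  by apply/funext => w; exact: pos_partE.
apply: cvgM; last exact: cvg_cst.
apply: cvgD; first exact: cvg_id.
by apply: cvg_norm; exact: cvg_id.
Qed.

(** The ray is run through for t <= 0, the segment for 0 <= t <= 1 and the graph
    for 1 <= t. A single formula in terms of positive parts makes continuity a
    matter of composition; the sine needs no shift by pi because its square has
    period pi. *)
Definition line_to_T (R : realType) (t : R) : plane R :=
  (pi + pos_part (t - 1) + pos_part (- t),
   sin (pos_part (t - 1)) ^+ 2 + ((pi + pos_part (t - 1))^-1 - pi^-1)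
   + (pos_part t - pos_part (t - 1)) / pi).

Lemma sin_sqrDpi (R : realType) (x : R) k :
  sin (x + pi *+ k) ^+ 2 = sin x ^+ 2.
Proof.
by rewrite (alternatingn (@sinDpi R)) exprMn sqrr_sign mul1r.
Qed.

Lemma line_to_T_graph (R : realType) (t : R) : 1 <= t ->
  line_to_T t = (pi + (t - 1), T_fun (pi + (t - 1))).
Proof.
move=> t1; have p0 : pi != 0 :> R by rewrite gt_eqF ?pi_gt0.
have [t0 t10 nt0] : [/\ 0 <= t, 0 <= t - 1 & - t <= 0] by split; lra.
rewrite /line_to_T !(pos_part_id t10) (pos_part_id t0) (pos_part_eq0 nt0).
rewrite addr0 /T_fun; congr pair.
have -> : pi + (t - 1) = (t - 1) + pi *+ 1 :> R by rewrite addrC.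
rewrite sin_sqrDpi -addrA; congr +%R.
have -> : t - (t - 1) = 1 by ring.
by rewrite div1r subrK.
Qed.

Lemma line_to_T_segment (R : realType) (t : R) : 0 <= t <= 1 ->
  line_to_T t = (pi, t / pi).
Proof.
move=> /andP[t0 t1]; have [t10 nt0] : t - 1 <= 0 /\ - t <= 0 by split; lra.
rewrite /line_to_T (pos_part_id t0) !(pos_part_eq0 t10) (pos_part_eq0 nt0).
by rewrite sin0 expr0n !addr0 subrr !subr0 !add0r.
Qed.

Lemma line_to_T_ray (R : realType) (t : R) : t <= 0 ->
  line_to_T t = (pi - t, 0).
Proof.
move=> t0; have [t10 nt0] : t - 1 <= 0 /\ 0 <= - t by split; lra.
rewrite /line_to_T !(pos_part_eq0 t10) (pos_part_eq0 t0) (pos_part_id nt0).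
by rewrite sin0 expr0n !addr0 !subrr !add0r mul0r.
Qed.

Lemma line_to_T_in (R : realType) (t : R) : line_to_T t \in T_space R.
Proof.
apply: mem_set; have [t0|t0] := leP t 0.
  rewrite line_to_T_ray//; left; right; exists (pi - t) => //.
  by rewrite /= in_itv /= andbT; lra.
have [t1|t1] := leP t 1.
  rewrite line_to_T_segment ?(ltW t0)//; right; exists (t / pi) => //.
  rewrite /= in_itv /= (divr_ge0 (ltW t0) (pi_ge0 R)) -[leRHS]mul1r.
  by rewrite ler_wpM2r// invr_ge0 pi_ge0.
rewrite line_to_T_graph ?ltW//; left; left; exists (pi + (t - 1)) => //.
by rewrite /= in_itv /= andbT; lra.
Qed.

Lemma line_to_T_onto (R : realType) (p : plane R) :
  T_space R p -> exists t, line_to_T t = p.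
Proof.
have p0 := pi_gt0 R.
case=> [[|]|] [x].
- rewrite /= in_itv /= andbT => x0 <-; exists (x - pi + 1).
  rewrite line_to_T_graph; last by lra.
  by have -> : pi + (x - pi + 1 - 1) = x by ring.
- rewrite /= in_itv /= andbT => x0 <-; exists (pi - x).
  rewrite line_to_T_ray; last by lra.
  by have -> : pi - (pi - x) = x by ring.
- rewrite /= in_itv /= => /andP[x0 x1] <-; exists (x * pi).
  rewrite line_to_T_segment ?mulfK ?gt_eqF//.
  by rewrite (mulr_ge0 x0 (ltW p0)) -ler_pdivlMr// div1r.
Qed.

Lemma continuous_line_to_T (R : realType) :
  continuous (fun t : R => (line_to_T t).1) /\
  continuous (fun t : R => (line_to_T t).2).
Proof.
have p0 := pi_gt0 R.
have cT1 : continuous (fun t : R => pos_part (t - 1)).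
  move=> t; apply: (@continuous_comp _ _ _ (fun t : R => t - 1));
    last exact: continuous_pos_part.
  by apply: cvgB; [exact: cvg_id|exact: cvg_cst].
split=> t.
  apply: cvgD; first by apply: cvgD; [exact: cvg_cst|exact: cT1].
  apply: (@continuous_comp _ _ _ -%R); last exact: continuous_pos_part.
  exact: opp_continuous.
apply: cvgD; first apply: cvgD.
- rewrite /=; under eq_fun do rewrite expr2.
  by apply: cvgM; apply: (continuous_comp (cT1 t)); exact: continuous_sin.
- apply: cvgB; last exact: cvg_cst.
  apply: cvgV; first by rewrite gt_eqF// ltr_wpDr ?pos_part_ge0.
  by apply: cvgD; [exact: cvg_cst|exact: cT1].
- apply: cvgM; last exact: cvg_cst.
  by apply: cvgB; [exact: continuous_pos_part|exact: cT1].
Qed.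

Lemma T_space_path_connected (R : realType) : path_connected R (T_space R).
Proof.
move=> [p pT] [q qT].
have [a ap] := line_to_T_onto (set_mem pT).
have [b bq] := line_to_T_onto (set_mem qT).
pose l (s : R) : R := a + s * (b - a).
exists (fun s => SigSub (line_to_T_in (l s))); split; last first.
- by apply/val_inj; rewrite /= -bq /l mul1r subrKC.
- by apply/val_inj; rewrite /= -ap /l mul0r addr0.
apply: continuous_subspaceT => s; apply/cvg_app_entourageP => E.
move/entourage_T_spaceP => [e e0 eE].
have [c1 c2] := continuous_line_to_T R.
have cl : continuous l.
  move=> r; apply: cvgD; first exact: cvg_cst.
  by apply: cvgM; [exact: cvg_id|exact: cvg_cst].
have e20 : 0 < e / 2 by rewrite divr_gt0.
have d1 : \forall r \near s,
    `|(line_to_T (l s)).1 - (line_to_T (l r)).1| <= e / 2.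
  exact: (@cvgr_dist_le _ _ _ _ _ _ _ (continuous_comp (cl s) (c1 _)) _ e20).
have d2 : \forall r \near s,
    `|(line_to_T (l s)).2 - (line_to_T (l r)).2| <= e / 2.
  exact: (@cvgr_dist_le _ _ _ _ _ _ _ (continuous_comp (cl s) (c2 _)) _ e20).
near=> r; apply: eE => /=; apply: le_trans (euclidean_dist_le_coord _ _) _.
by rewrite (splitr e) lerD//; near: r.
Unshelve. all: by end_near. Qed.

(** * Cocycles on the Rips complex *)

Definition cochain_sum (X : Type) (V : zmodType) (phi : X -> X -> V)
    (c : seq X) : V :=
  if c is x :: s then \sum_(v <- pairmap phi x s) v else 0.

Definition cocycle (X : Type) (V : zmodType) (E : set (X * X))
    (phi : X -> X -> V) : Prop :=
  forall a b c, E (a, b) -> E (b, c) -> E (a, c) -> phi a b + phi b c = phi a c.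

Lemma cocycle_diag (X : Type) (V : zmodType) (E : set (X * X))
    (phi : X -> X -> V) a : cocycle E phi -> E (a, a) -> phi a a = 0.
Proof. by move=> co Eaa; apply: (addIr (phi a a)); rewrite add0r co. Qed.

(** A new interior point replaces one edge of a triangle by the two others; a new
    first or last point repeats the endpoint, and its edge is degenerate. *)
Lemma cochain_sum_add_point (X : Type) (V : zmodType) (E : set (X * X))
    (phi : X -> X -> V) x y c d : cocycle E phi ->
  chain E x y c -> chain E x y d -> add_point c d ->
  cochain_sum phi d = cochain_sum phi c.
Proof.
move=> co Ec Ed [s [z [t [cE dE]]]]; subst c d.
case: s Ec Ed => [|a s].
  case: t => //= a t [-> _ _] [-> /andP[/asboolP Exx _] _].
  by rewrite big_cons (cocycle_diag co) // add0r.
move=> [ax /= + +] [_ /= + +]; subst a.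
rewrite !cat_path !last_cat !pairmap_cat !big_cat /=.
case: t => [|b t] /=.
  rewrite big_seq1 big_nil addr0 => _ -> /andP[_ /andP[/asboolP Eyz _]] zy.
  by move: Eyz; rewrite zy => /(cocycle_diag co) ->; rewrite addr0.
move=> /andP[_ /andP[/asboolP Elb _]] _.
move=> /and3P[_ /asboolP Elz /andP[/asboolP Ezb _]] _.
by rewrite !big_cons; congr +%R; rewrite addrA co.
Qed.

Lemma cochain_sum_homotopic (X : Type) (V : zmodType) (E : set (X * X))
    (phi : X -> X -> V) x y c d : cocycle E phi ->
  homotopic E x y c d -> cochain_sum phi c = cochain_sum phi d.
Proof.
move=> co [_ _]; elim=> [a b [Ea Eb [ab|ba]]|//|a b e _ -> _ ->//].
- by rewrite (cochain_sum_add_point co Ea Eb ab).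
- by rewrite (cochain_sum_add_point co Eb Ea ba).
Qed.

Lemma cochain_sum_eq0 (X : Type) (V : zmodType) (E : set (X * X))
    (phi : X -> X -> V) x y c :
  (forall a b, E (a, b) -> phi a b = 0) -> chain E x y c ->
  cochain_sum phi c = 0.
Proof.
move=> phi0; case: c => // z s [_ + _] /=.
elim: s z => [|a s IH] z /=; first by rewrite big_nil.
by move=> /andP[/asboolP/phi0 za /IH s0]; rewrite big_cons za s0 addr0.
Qed.

(** The representatives c D and c E of a generalized path are E-homotopic, and
    shortness says that the latter is E-homotopic to x, y. Thus the value of an
    E-cocycle on the edge (x, y) can be computed on a chain as fine as desired. *)
Lemma short_class_sum (X : uniformType) (V : zmodType) (E D : sentourage X)
    (phi : X -> X -> V) x y (alpha : generalized_path x y) :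
  cocycle (sval E) phi -> sval D `<=` sval E -> short E alpha ->
  exists2 c, chain (sval D) x y c & cochain_sum phi c = phi x y.
Proof.
move=> co DE [_ alphaE]; have [c [Ec cE cDE]] := path_classP alpha.
exists (c D); first exact: Ec.
rewrite (cochain_sum_homotopic co (cDE E D DE)).
have: homotopy_class (sval E) x y (c E) (c E) by exact/homotopic_refl.
rewrite -cE alphaE => /(cochain_sum_homotopic co) <-.
by rewrite /= big_seq1.
Qed.

(** * Windows around the rungs *)

(** Abscissas where the square of the sine is 1. Consecutive ones enclose the
    rung at [pi *+ k.+1]. *)
Definition rung_bound (R : realType) (k : nat) : R := pi / 2 + pi *+ k.

(** At scale e, the graph stays away from the ray near the sides of every
    window, with the same e for all windows. With e < 1, being e-close to
    a side at positive k keeps a point to the right of the segment. *)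
Definition window_gap (R : realType) (e : R) : Prop :=
  [/\ 0 < e, e < 1 & forall k x, `|x - rung_bound R k| <= e -> e < sin x ^+ 2].

Lemma sin_sqr_rung_bound (R : realType) : exists e : R, window_gap e.
Proof.
have c1 : cos y * cos y @[y --> (0 : R)] --> (cos 0 * cos 0 : R).
  by apply: cvgM; exact: continuous_cos.
rewrite cos0 mulr1 in c1.
have half : 0 < 2^-1 :> R by rewrite invr_gt0.
have : \forall y \near (0 : R), `|1 - cos y * cos y| <= 2^-1.
  exact: (@cvgr_dist_le _ _ _ _ _ _ _ c1 _ half).
move=> /nbhs_ballP[d /= d0 dP].
(* Halved once more, because the ball of radius d is open and the bound on the
   square of the sine has to be strict. *)
exists (Num.min d 2^-1 / 2); split.
- by rewrite divr_gt0// lt_min d0 half.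
- by rewrite ltr_pdivrMr// gt_min; apply/orP; right; lra.
move=> k x; rewrite ler_pdivlMr// le_min => /andP[xd xh].
have {}dP := dP (x - rung_bound R k).
have -> : sin x ^+ 2 = cos (x - rung_bound R k) ^+ 2.
  rewrite -sinDpihalf -[RHS](sin_sqrDpi _ k); congr (sin _ ^+ 2).
  by rewrite /rung_bound; ring.
rewrite expr2; have := dP; rewrite -ball_normE /= sub0r normrN.
move=> /(_ _)/ler_normlP[|_ h].
  by lra.
have : Num.min d 2^-1 <= 2^-1 :> R by rewrite ge_min lexx orbT.
by lra.
Qed.

(** * The crossing cocycle *)

Lemma T_space_outside_segment (R : realType) (p : plane R) :
  T_space R p -> pi < p.1 -> p.2 = 0 \/ p.2 = T_fun p.1.
Proof.
case=> [[|]|] [x _ <-] /=; [by right|by left|by rewrite ltxx].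
Qed.

Definition in_window (R : realType) (k : nat) (p : plane R) : bool :=
  rung_bound R k < p.1 < rung_bound R k.+1.

(** Inside the window this is, up to sign, the coboundary of the indicator of the
    graph. It is cut off to 0 on edges that are not inside. *)
Definition crossing (R : realType) (k : nat) (u v : T_space R) : int :=
  if in_window k (val u) && in_window k (val v)
  then ((val u).2 != 0)%:R - ((val v).2 != 0)%:R else 0.

Lemma rung_boundS (R : realType) k :
  rung_bound R k.+1 = rung_bound R k + pi.
Proof. by rewrite /rung_bound mulrS; ring. Qed.

Lemma rung_bound_ge (R : realType) k : (0 < k)%N -> pi + 1 <= rung_bound R k.
Proof.
case: k => // k _; rewrite rung_boundS /rung_bound.
have : 0 <= (pi : R) *+ k by rewrite mulrn_wge0// pi_ge0.
have := pihalf_ge1 R; lra.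
Qed.

Definition close_pairs (R : realType) (e : R) : set (T_space R * T_space R) :=
  [set uv | euclidean_dist (val uv.1) (val uv.2) <= e].

Lemma close_pairs_sym (R : realType) (e : R) (u v : T_space R) :
  close_pairs e (u, v) -> close_pairs e (v, u).
Proof.
rewrite /close_pairs /= /euclidean_dist.
by rewrite -sqrrN opprB -[(_.2 - _) ^+ 2]sqrrN opprB.
Qed.

Lemma close_pairs_symmetric_entourage (R : realType) (e : R) : 0 < e ->
  @symmetric_entourage (T_space R) (close_pairs (R := R) e).
Proof.
move=> e0; split; first by apply/entourage_T_spaceP; exists e.
by apply/seteqP; split=> -[u v]; exact: close_pairs_sym.
Qed.

(** If points with positive height are higher than e, being e-close forces two
    points to lie both on the ray or both off it. *)
Lemma off_axis_of_gap (R : realType) (e : R) (u v : T_space R) :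
  close_pairs e (u, v) -> (val u).2 = 0 \/ e < (val u).2 ->
  (val v).2 = 0 \/ e < (val v).2 -> ((val u).2 != 0) = ((val v).2 != 0).
Proof.
move=> uv; have [_ uv2] := coord_le_euclidean_dist (val u) (val v).
have {uv}uv2' : `|(val u).2 - (val v).2| <= e by exact: le_trans uv2 uv.
have e0 : 0 <= e := le_trans (normr_ge0 _) uv2'.
have gt_neq0 (z : R) : e < z -> z != 0 by move=> ez; rewrite gt_eqF//; lra.
move=> [u0|ue] [v0|ve].
- by rewrite u0 v0.
- by move: uv2'; rewrite u0 sub0r normrN ler_norml; lra.
- by move: uv2'; rewrite v0 subr0 ler_norml; lra.
- by rewrite !gt_neq0.
Qed.

Lemma same_sheet (R : realType) (e : R) (k : nat) (u v : T_space R) :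
  window_gap e -> (0 < k)%N -> close_pairs e (u, v) ->
  `|(val u).1 - rung_bound R k| <= e -> `|(val v).1 - rung_bound R k| <= e ->
  ((val u).2 != 0) = ((val v).2 != 0).
Proof.
move=> [e0 e1 gap] k0 uv.
have sheet (w : T_space R) : `|(val w).1 - rung_bound R k| <= e ->
    (val w).2 = 0 \/ e < (val w).2.
  move=> wk; have pw : pi < (val w).1.
    by move: wk (rung_bound_ge R k0) e1; rewrite ler_norml; lra.
  have [w0|->] := T_space_outside_segment (set_mem (valP w)) pw; first by left.
  right; rewrite /T_fun ltr_wpDr ?(gap k)// invr_ge0.
  by rewrite (le_trans (pi_ge0 R))// ltW.
by move=> /sheet us /sheet vs; exact: off_axis_of_gap uv us vs.
Qed.

(** A triangle with a vertex inside the window and one outside lies horizontally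
    within e of the side of the window that separates them, where the graph and
    the ray are more than e apart. *)
Lemma leaving_window_sheet (R : realType) (e : R) (k : nat)
    (u v w : T_space R) :
  window_gap e -> (0 < k)%N -> close_pairs e (u, v) -> close_pairs e (u, w) ->
  close_pairs e (v, w) ->
  in_window k (val u) -> ~~ in_window k (val v) ->
  ((val u).2 != 0) = ((val v).2 != 0) /\ ((val v).2 != 0) = ((val w).2 != 0).
Proof.
move=> gap k0 uv uw vw /andP[ku uk]; rewrite /in_window negb_and -!leNgt.
have d1 (a b : T_space R) : close_pairs e (a, b) ->
    - e <= (val a).1 - (val b).1 <= e.
  move=> ab; rewrite -ler_norml; apply: le_trans ab.
  by have [] := coord_le_euclidean_dist (val a) (val b).
have := d1 _ _ uv; have := d1 _ _ uw; have := d1 _ _ vw => vw1 uw1 uv1.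
case/orP => h.
  by split; apply: (same_sheet gap k0) => //; rewrite ler_norml; lra.
by split; apply: (same_sheet (k := k.+1) gap) => //; rewrite ler_norml; lra.
Qed.

(** A triangle inside the window sees a coboundary, one outside sees 0, and one
    that is partly inside is contained in the graph or in the ray, where all
    values are 0. *)
Lemma crossing_cocycle (R : realType) (e : R) (k : nat) :
  window_gap e -> (0 < k)%N -> cocycle (close_pairs e) (@crossing R k).
Proof.
move=> gap k0 u v w uv vw uw.
have vu := close_pairs_sym uv; have wv := close_pairs_sym vw.
have leave := leaving_window_sheet gap k0.
rewrite /crossing.
have [iu|ou] := boolP (in_window k (val u));
  have [iv|ov] := boolP (in_window k (val v));
  have [iw|ow] := boolP (in_window k (val w)) => //=; rewrite ?addr0 ?add0r //.
- by rewrite subrKA.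
- by have [-> ->] := leave u w v uw uv wv iu ow; rewrite subrr.
- by have [-> ->] := leave u v w uv uw vw iu ov; rewrite subrr.
- by have [-> ->] := leave v u w vu vw uw iv ou; rewrite subrr.
Qed.

(** Since f x >= 1 / x, the graph over the window is at least as high as the
    inverse of the right end of the window, so e-close points are on the same
    sheet. *)
Lemma crossing_fine (R : realType) (e : R) (k : nat) (u v : T_space R) :
  (0 < k)%N -> e < (rung_bound R k.+1)^-1 -> close_pairs e (u, v) ->
  crossing k u v = 0.
Proof.
move=> k0 ek uv; rewrite /crossing; case: ifP => // /andP[iu iv].
suff -> : ((val u).2 != 0) = ((val v).2 != 0) by rewrite subrr.
have sheet (w : T_space R) : in_window k (val w) ->
    (val w).2 = 0 \/ e < (val w).2.
  move=> /andP[kw wk]; have := rung_bound_ge R k0; have := pi_gt0 R => p0 pk.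
  have pw : pi < (val w).1 by lra.
  have [w0|->] := T_space_outside_segment (set_mem (valP w)) pw; first by left.
  right; apply: (lt_le_trans ek); rewrite /T_fun.
  rewrite (@le_trans _ _ (val w).1^-1)// ?lerDr ?sqr_ge0//.
  by rewrite lef_pV2 ?posrE; lra.
exact: off_axis_of_gap uv (sheet u iu) (sheet v iv).
Qed.

(** * The theorem *)

Lemma T_space_not_locally_uniformly_joinable (R : realType) :
  ~ locally_uniformly_joinable (T_space R).
Proof.
have [e gap] := sin_sqr_rung_bound R; have [e0 _ _] := gap.
have p0 := pi_gt0 R.
pose ent d (d0 : 0 < d) : sentourage (T_space R) :=
  exist _ _ (close_pairs_symmetric_entourage d0).
move=> /(_ (ent e e0))[F joinF].
have /entourage_T_spaceP[d d0 dF] := (svalP F).1.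
(* The rung at x = (k + 1) pi is shorter than d, and its window, with sides
   [rung_bound R k] and [rung_bound R k.+1], is to the right of the segment
   since k is positive. *)
pose k := (Num.Def.archi_bound d^-1).+1.
pose x : R := pi *+ k.+1.
have x0 : 0 < x by rewrite pmulrn_lgt0.
have pix : pi <= x by rewrite /x mulrS lerDl mulrn_wge0// ltW.
have xd : x^-1 <= d.
  rewrite -[leRHS]invrK lef_pV2 ?posrE ?invr_gt0//.
  have /ltW dk := archi_boundP (ltW (eqbRL (invr_gt0 d) d0)).
  apply: (le_trans dk); apply: (@le_trans _ _ k.+1%:R).
    by rewrite ler_nat /k; exact: leqW (leqnSn _).
  by rewrite /x -[leRHS]mulr_natl ler_peMr//; have := pi_ge2 R; lra.
have fx : T_fun x = x^-1.
  by rewrite /T_fun /x -[pi *+ _]add0r sin_sqrDpi sin0 expr0n !add0r.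
have pT : (x, T_fun x) \in T_space R.
  by apply/mem_set; left; left; exists x => //; rewrite /= in_itv /= pix.
have qT : (x, 0) \in T_space R.
  by apply/mem_set; left; right; exists x => //; rewrite /= in_itv /= pix.
pose p : T_space R := SigSub pT; pose q : T_space R := SigSub qT.
have Fpq : sval F (p, q).
  apply: dF => /=; apply: le_trans (euclidean_dist_le_coord _ _) _.
  by rewrite /= subrr normr0 add0r subr0 fx ger0_norm// invr_ge0 ltW.
have [alpha shortE] := joinF p q Fpq.
(* Finer than e, and than the gap between graph and ray over the window. *)
pose r := Num.min e ((rung_bound R k.+1)^-1 / 2).
have b0 : 0 < (rung_bound R k.+1)^-1.
  by rewrite invr_gt0; have := @rung_bound_ge R k.+1 isT; lra.
have r0 : 0 < r by rewrite lt_min e0 divr_gt0.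
have re : sval (ent r r0) `<=` sval (ent e e0).
  by move=> uv /= uvr; apply: le_trans uvr _; rewrite /r ge_min lexx.
have coc := @crossing_cocycle R e k gap isT.
have [c Dc] := short_class_sum (E := ent e e0) (D := ent r r0) coc re shortE.
rewrite (cochain_sum_eq0 _ Dc); last first.
  move=> a b; apply: crossing_fine => //.
  have : r <= (rung_bound R k.+1)^-1 / 2 by rewrite /r ge_min lexx orbT.
  by lra.
have wx : in_window k (x, 0).
  rewrite /in_window /= (rung_boundS R k) /rung_bound /x (mulrS pi k).
  move: (pi *+ k) => z; lra.
rewrite /crossing /= {1}/in_window /=; move: wx; rewrite /in_window /= => ->.
by rewrite fx eqxx invr_eq0 (gt_eqF x0).
Qed.

Theorem mainTheorem1 (R : realType) :
  [/\ path_connected R (T_space R),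
      uniformly_joinable (T_space R)
    & ~ locally_uniformly_joinable (T_space R)].
Proof.
have pcT := @T_space_path_connected R.
split; [exact: pcT| |exact: T_space_not_locally_uniformly_joinable].
exact: path_connected_uniformly_joinable pcT.
Qed.
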